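(* Assume that the KKT solution set $\Omega^*$ is nonempty and that $\mathcal P_f\succeq0$, $\mathcal P_g\succeq0$, $\mathcal P_f+\sigma A^*A\succ0$, $\mathcal P_g+\sigma B^*B\succ0$. Let $\beta\in(0,1]$ be such that for every $w_1,w_2\in\mathbb H$, with $\Delta w:=w_1-w_2$ and $\Delta\mathcal F_{sm}:=\mathcal F_{sm}(w_1)-\mathcal F_{sm}(w_2)$, $$\Delta\mathcal F_{sm}\in\operatorname{Im}(\mathcal M)\qquad\text{and}\qquad\langle\Delta\mathcal F_{sm},\Delta w\rangle\ge\frac1{2\beta}\|\Delta\mathcal F_{sm}\|_{\mathcal M^\dagger}^2 ,$$ and let $0<\rho\le2-\beta$. If $\{w^k\}$ is generated from $w^0\in\mathbb H$ by the Halpern-accelerated majorized ADMM described in the context, then, for every $w^*\in\Omega^*$ and $k\ge0$, $$\|w^k-\widehat{\mathbf T}w^k\|_{\mathcal M}\le\frac{2\|w^0-w^*\|_{\mathcal M}}{k+1}.$$ Equivalently, $$\|w^k-\mathbf Tw^k\|_{\mathcal M}\le\frac{2\|w^0-w^*\|_{\mathcal M}}{\rho(k+1)}.$$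
   Context: **Setting.** $\mathbb X,\mathbb Y,\mathbb Z$ are finite-dimensional Euclidean spaces, each with an inner product $\langle\cdot,\cdot\rangle$ and induced norm $\|\cdot\|$; $\mathbb H:=\mathbb Y\times\mathbb Z\times\mathbb X$ carries the product inner product, with elements $w=(y,z,x)$. $p:\mathbb Y\to(-\infty,+\infty]$ and $q:\mathbb Z\to(-\infty,+\infty]$ are closed proper convex; $f:\mathbb Y\to\mathbb R$ and $g:\mathbb Z\to\mathbb R$ are convex and differentiable with Lipschitz continuous gradients; $A:\mathbb Y\to\mathbb X$, $B:\mathbb Z\to\mathbb X$ are linear with adjoints $A^*,B^*$; $c\in\mathbb X$. The problem is $\min_{y,z}\ p(y)+f(y)+q(z)+g(z)$ subject to $Ay+Bz=c$. For a self-adjoint linear operator $\Sigma$ (possibly indefinite), $\|v\|_\Sigma^2:=\langle v,\Sigma v\rangle$; $\Sigma\succeq0$ (resp. $\succ0$) means positive semidefinite (resp. definite); $\operatorname{Im}(\Sigma)$ is the range and $\Sigma^\dagger$ the Moore--Penrose pseudoinverse. **Majorization.** $\widehat\Sigma_f$ on $\mathbb Y$ and $\widehat\Sigma_g$ on $\mathbb Z$ are self-adjoint positive semidefinite linear operators such that, with $\hat f(y,y'):=f(y')+\langle\nabla f(y'),y-y'\rangle+\tfrac12\|y-y'\|_{\widehat\Sigma_f}^2$ and $\hat g(z,z'):=g(z')+\langle\nabla g(z'),z-z'\rangle+\tfrac12\|z-z'\|_{\widehat\Sigma_g}^2$, one has $f(y)\le\hat f(y,y')$ and $g(z)\le\hat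 g(z,z')$ for all $y,y'\in\mathbb Y$, $z,z'\in\mathbb Z$. Let $\sigma>0$, let $\mathcal S$ on $\mathbb Y$ and $\mathcal T$ on $\mathbb Z$ be self-adjoint linear operators (not necessarily semidefinite), and set $\mathcal P_f:=\mathcal S+\widehat\Sigma_f$, $\mathcal P_g:=\mathcal T+\widehat\Sigma_g$. **Operators on $\mathbb H$.** With $\partial$ the convex subdifferential, $$\mathcal R_{ns}(w)=\begin{pmatrix}\partial p(y)+A^*x\\ \partial q(z)+B^*x\\ -Ay-Bz+c\end{pmatrix},\quad \mathcal F_{sm}(w)=\begin{pmatrix}\nabla f(y)\\ \nabla g(z)\\ 0\end{pmatrix},\quad \mathcal R=\mathcal R_{ns}+\mathcal F_{sm},$$ $$\mathcal M=\begin{pmatrix}\mathcal P_f+\sigma A^*A&0&A^*\\ 0&\mathcal P_g&0\\ A&0&\sigma^{-1}I\end{pmatrix}.$$ Under the stated hypotheses $\mathcal M\succeq0$ (possibly singular), so $\|w\|_{\mathcal M}=\langle w,\mathcal Mw\rangle^{1/2}$ is a seminorm. The KKT solution set is $\Omega^*:=\{w\in\mathbb H:0\in\mathcal R_{ns}(w)+\mathcal F_{sm}(w)\}$. **The mappings $\mathbf T$ and $\widehat{\mathbf T}$.** $\mathbf T=(\mathcal M+\mathcal R_{ns})^{-1}(\mathcal M-\mathcal F_{sm})$, i.e. $\mathbf T(w)$ is the point $w^+\in\mathbb H$ with $\mathcal Mw-\mathcal F_{sm}(w)\in\mathcal Mw^++\mathcal R_{ns}(w^+)$; under the stated positive (semi)definiteness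 hypotheses such a $w^+$ exists and is unique for every $w\in\mathbb H$. The relaxed mapping is $\widehat{\mathbf T}:=(1-\rho)I+\rho\mathbf T$. **Halpern-accelerated majorized ADMM.** Given $w^0=(y^0,z^0,x^0)\in\mathbb H$ and $\lambda_k=\frac1{k+2}$, for $k=0,1,2,\dots$: 1. $\tilde z^{k+1}=\arg\min_z\{q(z)+\hat g(z,z^k)+\langle B^*x^k,z\rangle+\frac\sigma2\|Ay^k+Bz-c\|^2+\frac12\|z-z^k\|_{\mathcal T}^2\}$; 2. $\tilde x^{k+1}=x^k+\sigma(Ay^k+B\tilde z^{k+1}-c)$; 3. $\tilde y^{k+1}=\arg\min_y\{p(y)+\hat f(y,y^k)+\langle A^*\tilde x^{k+1},y\rangle+\frac\sigma2\|Ay+B\tilde z^{k+1}-c\|^2+\frac12\|y-y^k\|_{\mathcal S}^2\}$; 4. with $\widetilde w^{k+1}=(\tilde y^{k+1},\tilde z^{k+1},\tilde x^{k+1})$, $\widehat w^{k+1}=(1-\rho)w^k+\rho\widetilde w^{k+1}$; 5. $w^{k+1}=\lambda_kw^0+(1-\lambda_k)\widehat w^{k+1}$. Here $\widetilde w^{k+1}=\mathbf T(w^k)$, so the algorithm is the iteration $w^{k+1}=\lambda_kw^0+(1-\lambda_k)\widehat{\mathbf T}(w^k)$. *)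

(* Defs.v *)
From HB Require Import structures.
From mathcomp Require Import all_boot all_order all_algebra.
From mathcomp Require Import all_classical reals ereal topology normedtype.
From mathcomp Require Import derive convex.
Set Implicit Arguments.
Unset Strict Implicit.
Unset Printing Implicit Defensive.
Import Order.TTheory GRing.Theory Num.Theory.
Import numFieldNormedType.Exports.
Local Open Scope classical_set_scope.
Local Open Scope ring_scope.

HB.mixin Record NormedVector_isEuclidean (R : realType) V
    & NormedModule R V & Vector R V := {
  edot : {dot V for (@idfun R)} ;
  enormE : forall v : V, `|v| = Num.sqrt (edot v v)
}.

#[short(type="euclideanType")]
HB.structure Definition Euclidean (R : realType) :=
  {V of NormedVector_isEuclidean R V & NormedModule R V & Vector R V}.

Arguments edot {R s}.

Section Forms.
Variable R : realType.

Section OneForm.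
Variables (U : vectType R) (dU : {dot U for (@idfun R)}).

Lemma formDl (u v w : U) : dU (u + v) w = dU u w + dU v w.
Proof. by rewrite linearDl. Qed.
Lemma formBl (u v w : U) : dU (u - v) w = dU u w - dU v w.
Proof. by rewrite linearBl. Qed.
Lemma formZl a (u w : U) : dU (a *: u) w = a * dU u w.
Proof. by rewrite linearZl_LR. Qed.
Lemma formDr (u v w : U) : dU w (u + v) = dU w u + dU w v.
Proof. by rewrite linearDr. Qed.
Lemma formBr (u v w : U) : dU w (u - v) = dU w u - dU w v.
Proof. by rewrite linearBr. Qed.
Lemma formZr a (u w : U) : dU w (a *: u) = a * dU w u.
Proof. by rewrite linearZr_LR. Qed.
Lemma formC (u w : U) : dU u w = dU w u.
Proof. by rewrite hermC /= expr0 mul1r. Qed.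

Lemma form_eq0 (u : U) : dU u u = 0 -> u = 0.
Proof.
move=> u0; apply/eqP/contraT => un0.
by have := @neq0_dnorm_gt0 _ _ _ dU u un0; rewrite u0 ltxx.
Qed.

Lemma form_inj (u u' : U) : (forall v, dU u v = dU u' v) -> u = u'.
Proof.
move=> uu'; apply/eqP; rewrite -subr_eq0; apply/eqP/form_eq0.
by rewrite formBl uu' subrr.
Qed.

Lemma riesz (phi : {linear U -> R^o}) : exists u, forall v, phi v = dU u v.
Proof.
pose b := vbasis (fullv : {vspace U}).
pose G u : 'rV[R]_(\dim (fullv : {vspace U})) := \row_i dU u b`_i.
have Glin : linear G.
  by move=> a u v; apply/rowP => i; rewrite !mxE formDl formZl.
pose GL := GRing.isLinear.Build _ _ _ _ G Glin.
pose G' : {linear U -> _} := HB.pack G GL.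
pose g := linfun G'.
have bv v : v = \sum_(i < \dim (fullv : {vspace U})) coord b i v *: b`_i.
  by apply: coord_vbasis; rewrite memvf.
have kg : lker g == 0%VS.
  rewrite -subv0; apply/subvP => u; rewrite memv_ker lfunE /= memv0 => /eqP Gu.
  apply/eqP/form_eq0; rewrite {2}(bv u) raddf_sum /= big1 // => i _.
  by rewrite formZr; move/rowP/(_ i): Gu; rewrite !mxE => ->; rewrite mulr0.
have dg : limg g = fullv.
  apply/eqP; rewrite eqEdim subvf /= limg_dim_eq; last first.
    by apply/eqP; rewrite (eqP kg) capv0.
  by rewrite dimvf /dim /= mul1n.
have : (\row_i phi b`_i) \in limg g by rewrite dg memvf.
case/memv_imgP => u _; rewrite lfunE /= => /rowP phiu.
exists u => v; rewrite {1}(bv v) [in RHS](bv v) !raddf_sum /=.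
apply: eq_bigr => i _; rewrite linearZ_LR formZr.
by have := phiu i; rewrite !mxE => ->.
Qed.

End OneForm.

Section Adjoint.
Variables (U V : vectType R).
Variables (dU : {dot U for (@idfun R)}) (dV : {dot V for (@idfun R)}).

Definition adjoint (A : 'Hom(U, V)) : 'Hom(V, U) :=
  xget 0 [set B : 'Hom(V, U) | forall u v, dV (A u) v = dU u (B v)].

Lemma adjointE (A : 'Hom(U, V)) u v : dV (A u) v = dU u (adjoint A v).
Proof.
move: u v; apply: (xgetPex 0 (P := [set B : 'Hom(V, U) | forall u v, _ = dU u (B v)])).
have /choice [B BP] v : exists b, forall u, dV (A u) v = dU b u.
  pose phi u : R^o := dV (A u) v.
  have phil : linear phi.
    by move=> a x y; rewrite /phi linearP formDl formZl.
  pose phiL := GRing.isLinear.Build _ _ _ _ phi phil.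
  pose phi' : {linear U -> R^o} := HB.pack phi phiL.
  exact: (riesz dU phi').
have Bl : linear B.
  move=> a x y; apply: (form_inj (dU := dU)) => u.
  by rewrite formDl formZl -!BP formDr formZr.
pose BL := GRing.isLinear.Build _ _ _ _ B Bl.
pose B' : {linear V -> U} := HB.pack B BL.
by exists (linfun B') => u v; rewrite lfunE /= BP formC.
Qed.

End Adjoint.

Section Endomorphisms.
Variables (U : vectType R) (dU : {dot U for (@idfun R)}).
Implicit Type S : 'End(U).

Definition selfadjoint S := forall u v, dU (S u) v = dU u (S v).
Definition psd S := forall u, 0 <= dU u (S u).
Definition pd S := forall u, u != 0 -> 0 < dU u (S u).

Definition qform S u : R := dU u (S u).
Definition qnorm S u : R := Num.sqrt (qform S u).

(* the four Penrose equations *)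
Definition is_mpinv S N : Prop :=
  [/\ (S \o N \o S)%VF = S, (N \o S \o N)%VF = N,
      selfadjoint (S \o N)%VF & selfadjoint (N \o S)%VF].

Definition mpinv S : 'End(U) := xget 0 [set N : 'End(U) | is_mpinv S N].

Lemma mpinvP S : selfadjoint S -> is_mpinv S (mpinv S).
Proof.
move=> saS; apply: (xgetPex 0 (P := [set N : 'End(U) | is_mpinv S N])).
have kcap : (limg S :&: lker S = 0)%VS.
  apply/eqP; rewrite -subv0; apply/subvP => x; rewrite memv_cap => /andP[].
  case/memv_imgP => v _ ->; rewrite memv_ker memv0 => /eqP SSv.
  by apply/eqP/(form_eq0 (dU := dU)); rewrite saS SSv linear0r.
have full : (limg S + lker S = fullv)%VS.
  apply/eqP; rewrite eqEdim subvf /= dimv_disjoint_sum // addnC.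
  by have := limg_ker_dim S fullv; rewrite capfv => ->.
pose P := daddv_pi (limg S) (lker S).
have PS x : P (S x) = S x.
  by apply: daddv_pi_id => //; apply: memv_img; rewrite memvf.
have SP x : S (P x) = S x.
  have xf : x \in (limg S + lker S)%VS by rewrite full memvf.
  have : daddv_pi (lker S) (limg S) x \in lker S by exact: memv_pi.
  rewrite memv_ker => /eqP Sx0.
  by rewrite -[in RHS](daddv_pi_add kcap xf) linearD /= Sx0 addr0.
have PP x : P (P x) = P x.
  by apply: daddv_pi_id => //; exact: memv_pi.
have Plim x : S ((S^-1)%VF (P x)) = P x.
  by apply: limg_lfunVK; exact: memv_pi.
have Pker x : S x = 0 -> P x = 0.
  move=> Sx; have : P x \in (limg S :&: lker S)%VS.
    by rewrite memv_cap memv_pi /= memv_ker SP Sx.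
  by rewrite kcap memv0 => /eqP.
have PVS x : P ((S^-1)%VF (S x)) = P x.
  apply/eqP; rewrite -subr_eq0 -linearB; apply/eqP/Pker.
  rewrite linearB /= limg_lfunVK ?subrr //.
  by apply: memv_img; rewrite memvf.
have Porth x y : dU (P x) (y - P y) = 0.
  by rewrite -(Plim x) saS linearB /= SP subrr linear0r.
have saP x y : dU (P x) y = dU x (P y).
  rewrite -[LHS]subr0 -[X in _ - X](Porth x y) formBr opprB addrC subrK.
  have := Porth y x; rewrite formBr formC [X in _ - X]formC => /eqP.
  by rewrite subr_eq0 => /eqP.
exists (P \o (S^-1)%VF \o P)%VF; split.
- by apply/lfunP => x; rewrite !comp_lfunE SP Plim PS.
- apply/lfunP => x; rewrite !comp_lfunE.
  by rewrite SP Plim PP.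
- by move=> x y; rewrite !comp_lfunE !SP !Plim saP.
- by move=> x y; rewrite !comp_lfunE !PS !PVS saP.
Qed.

End Endomorphisms.
End Forms.

Section Convex.
Variable (R : realType) (V : euclideanType R).
Implicit Types (p : V -> \bar R) (f : V -> R).

Definition proper p := (forall x, -oo < p x)%E /\ exists x, (p x < +oo)%E.

Definition econvex p := forall (x y : V) (t : R), 0 <= t <= 1 ->
  (p (t *: x + (1 - t) *: y)%R <= t%:E * p x + (1 - t)%:E * p y)%E.

Definition closed_proper_convex p :=
  [/\ lower_semicontinuous p, proper p & econvex p].

Definition subdiff p (x : V) : set V :=
  [set u | forall y, (p x + (edot u (y - x))%:E <= p y)%E].

Definition argmin p : set V := [set x | forall y, (p x <= p y)%E].

Definition grad f (x : V) : V :=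
  xget 0 [set u | forall h, 'd f x h = edot u h].

Lemma gradE f x h : 'd f x h = edot (grad f x) h.
Proof.
move: h; apply: (xgetPex 0 (P := [set u | forall h, 'd f x h = edot u h])).
exact: (riesz edot ('d f x)).
Qed.

Definition major f (S : 'End(V)) (x x' : V) : R :=
  f x' + edot (grad f x') (x - x') + 2^-1 * qform edot S (x - x').

End Convex.

Section ProductSpace.
Variables (R : realType) (Y Z X : euclideanType R).
Local Notation H := (Y * Z * X)%type.

(* The library norm on [H] is the max norm; the Euclidean structure of the product
   is always referred to through [pdot]. *)
Definition pdot (w w' : H) : R :=
  edot w.1.1 w'.1.1 + edot w.1.2 w'.1.2 + edot w.2 w'.2.

Lemma pdot_hermitian (w w' : H) :
  pdot w w' = (-1) ^+ false * idfun (pdot w' w).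
Proof.
by rewrite /= expr0 mul1r /pdot; congr (_ + _ + _); exact: formC.
Qed.

Lemma pdot_bilinear : bilinear_for
  (GRing.Scale.Law.clone _ _ ( *%R ) _)
  (GRing.Scale.Law.clone _ _ ((@idfun R) \; *%R ) _) pdot.
Proof.
have lin u' a u v : pdot (a *: u + v) u' = a * pdot u u' + pdot v u'.
  rewrite /pdot /= !formDl !formZl !mulrDr.
  by rewrite [X in X + _ = _]addrACA [LHS]addrACA.
split=> [u' a u v|u a u' v] /=; first exact: lin.
have C x x' : pdot x x' = pdot x' x by rewrite pdot_hermitian /= expr0 mul1r.
by rewrite (C u (a *: u' + v)) (C u u') (C u v); exact: lin.
Qed.

HB.instance Definition _ :=
  bilinear_isBilinear.Build R H H R _ _ pdot pdot_bilinear.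
HB.instance Definition _ :=
  @isHermitianSesquilinear.Build R H false idfun pdot pdot_hermitian.

Lemma pdot_gt0 (w : H) : w != 0 -> 0 < pdot w w.
Proof.
have ge0 (V : euclideanType R) (v : V) : 0 <= edot v v.
  have [->|vn0] := eqVneq v 0; first by rewrite linear0r.
  exact/ltW/neq0_dnorm_gt0.
have gt0 (V : euclideanType R) (v : V) : v != 0 -> 0 < edot v v.
  exact: neq0_dnorm_gt0.
case: w => [[y z] x] w0; rewrite /pdot /=.
have [y0|/gt0 y0] := eqVneq y 0; last by rewrite -addrA ltr_wpDr ?addr_ge0.
have [z0|/gt0 z0] := eqVneq z 0; last by rewrite ltr_wpDr // ltr_wpDl.
have [x0|/gt0 x0] := eqVneq x 0; last by rewrite ltr_wpDl ?addr_ge0.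
by move: w0; rewrite y0 z0 x0 eqxx.
Qed.

HB.instance Definition _ := isDotProduct.Build R H pdot pdot_gt0.

End ProductSpace.
Arguments pdot {R Y Z X}.

Section ADMM.
Variables (R : realType) (Y Z X : euclideanType R).
Local Notation H := (Y * Z * X)%type.
Variables (p : Y -> \bar R) (q : Z -> \bar R) (f : Y -> R) (g : Z -> R).
Variables (A : 'Hom(Y, X)) (B : 'Hom(Z, X)) (c : X) (sigma : R).

Local Notation adj := (adjoint edot edot).

Definition Rns (w : H) : set H :=
  [set (u + adj A w.2, v + adj B w.2, - A w.1.1 - B w.1.2 + c)
     | u in subdiff p w.1.1 & v in subdiff q w.1.2].

Definition Fsm (w : H) : H := (grad f w.1.1, grad g w.1.2, 0).

Definition KKT : set H := [set w | exists2 v, Rns w v & v + Fsm w = 0].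

Definition block (Pf : 'End(Y)) (Pg : 'End(Z)) (w : H) : H :=
  (Pf w.1.1 + sigma *: adj A (A w.1.1) + adj A w.2,
   Pg w.1.2,
   A w.1.1 + sigma^-1 *: w.2).

Definition Mop (Pf : 'End(Y)) (Pg : 'End(Z)) : 'End(H) := linfun (block Pf Pg).

Lemma MopE Pf Pg w : Mop Pf Pg w = block Pf Pg w.
Proof.
have bl : linear (block Pf Pg).
  move=> a [[y z] x] [[y' z'] x']; congr (_, _, _) => /=.
  - rewrite !linearP /= !scalerDr !scalerA.
    by rewrite [X in X + _ = _]addrACA [LHS]addrACA.
  - by rewrite linearP.
  - by rewrite !linearP /= !scalerDr !scalerA addrACA.
pose bL := GRing.isLinear.Build _ _ _ _ (block Pf Pg) bl.
pose b' : {linear H -> H} := HB.pack (block Pf Pg) bL.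
by rewrite -[block Pf Pg]/(b' : H -> H) /Mop -[block Pf Pg]/(b' : H -> H) lfunE.
Qed.

(* [w' \in (M + Rns)^-1 ((M - Fsm) w)]; [Tmap] returns the default value 0 at a
   point with no such [w']. *)
Definition Tgraph (M : 'End(H)) (w w' : H) : Prop :=
  exists2 v, Rns w' v & M w - Fsm w = M w' + v.

Definition Tmap (M : 'End(H)) (w : H) : H := xget 0 [set w' | Tgraph M w w'].

Definition relaxed (rho : R) (T : H -> H) (w : H) : H :=
  (1 - rho) *: w + rho *: T w.

Variables (Sf : 'End(Y)) (Sg : 'End(Z)) (S : 'End(Y)) (T : 'End(Z)).

Definition zobj (w : H) (z : Z) : \bar R :=
  (q z + (major g Sg z w.1.2 + edot (adj B w.2) z
          + sigma / 2 * `|A w.1.1 + B z - c| ^+ 2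
          + 2^-1 * qform edot T (z - w.1.2))%R%:E)%E.

Definition yobj (yk : Y) (z : Z) (x : X) (y : Y) : \bar R :=
  (p y + (major f Sf y yk + edot (adj A x) y
          + sigma / 2 * `|A y + B z - c| ^+ 2
          + 2^-1 * qform edot S (y - yk))%R%:E)%E.

(* [wt] is the point computed from the iterate [w] before relaxation. *)
Definition admm_step (w wt : H) : Prop :=
  [/\ argmin (zobj w) wt.1.2,
      wt.2 = w.2 + sigma *: (A w.1.1 + B wt.1.2 - c) &
      argmin (yobj w.1.1 wt.1.2 wt.2) wt.1.1].

Definition halpern_admm (rho : R) (w : nat -> H) : Prop :=
  forall k, exists2 wt, admm_step (w k) wt &
    let lambda : R := k.+2%:R^-1 in
    w k.+1 = lambda *: w 0%N
             + (1 - lambda) *: ((1 - rho) *: w k + rho *: wt).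

End ADMM.

(* Main.v *)
(* The optimality conditions of the two subproblems say that an ADMM step
   computes [T], a forward-backward step for the (possibly singular) metric [M].
   Writing the gradient increment as [M a], monotonicity of [Rns] and Young's
   inequality turn the cocoercivity hypothesis into
   [<dw - dt, dw>_M >= (1 - beta / 2) |dw - dt|_M^2], so the relaxed mapping is
   nonexpansive for the seminorm of [M] as soon as [rho <= 2 - beta].  Lieder's
   argument for the Halpern iteration only uses the Cauchy-Schwarz inequality and
   nonexpansiveness along the iterates and towards a fixed point, hence applies
   to a seminorm and yields the O(1 / k) rate with constant 2. *)
Require Import Defs.
From HB Require Import structures.
From mathcomp Require Import all_boot all_order all_algebra.
From mathcomp Require Import all_classical reals ereal topology normedtype.
From mathcomp Require Import derive convex.
From mathcomp Require Import ring lra.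
Import Order.TTheory GRing.Theory Num.Theory.
Import numFieldNormedType.Exports.
(* Re-imported because [sesquilinear] has homonyms of [formC], [formDl], etc. *)
Import Defs.
Local Open Scope classical_set_scope.
Local Open Scope ring_scope.

Set Implicit Arguments.
Unset Strict Implicit.

Lemma formNl {R : realType} {U : vectType R} (dU : {dot U for (@idfun R)})
  (u w : U) : dU (- u) w = - dU u w.
Proof. exact: linearNl. Qed.

Lemma formNr {R : realType} {U : vectType R} (dU : {dot U for (@idfun R)})
  (u w : U) : dU w (- u) = - dU w u.
Proof. exact: linearNr. Qed.

Lemma qformDZ {R : realType} {U : vectType R} (dU : {dot U for (@idfun R)})
    (S : 'End(U)) (u h : U) (t : R) : selfadjoint dU S ->
  qform dU S (u + t *: h) =
    qform dU S u + 2 * t * dU (S u) h + t ^+ 2 * qform dU S h.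
Proof.
move=> saS; rewrite /qform linearD linearZ !formDl !formDr !formZl !formZr /=.
by rewrite -(saS u h) [dU h (S u)]formC; ring.
Qed.

(** * Seminorm of a positive semidefinite operator: Cauchy-Schwarz, Halpern iteration, relaxation *)

Section SemiInnerProduct.
Context {R : realType} {U : vectType R} {dU : {dot U for (@idfun R)}}.
Context {M : 'End(U)} (saM : selfadjoint dU M) (psdM : psd dU M).
Implicit Types u v w : U.

Let m u v : R := dU u (M v).

Let mC u v : m u v = m v u. Proof. by rewrite /m -saM formC. Qed.
Let mDl u v w : m (u + v) w = m u w + m v w. Proof. exact: formDl. Qed.
Let mNl u w : m (- u) w = - m u w. Proof. exact: formNl. Qed.
Let mZl a u w : m (a *: u) w = a * m u w. Proof. exact: formZl. Qed.
Let mDr u v w : m w (u + v) = m w u + m w v.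
Proof. by rewrite /m linearD formDr. Qed.
Let mNr u w : m w (- u) = - m w u. Proof. by rewrite mC mNl mC. Qed.
Let mZr a u w : m w (a *: u) = a * m w u.
Proof. by rewrite /m linearZ formZr. Qed.

Let mE := (mDl, mNl, mZl, mDr, mNr, mZr).

Lemma qform_CauchySchwarz u v :
  dU u (M v) ^+ 2 <= qform dU M u * qform dU M v.
Proof.
rewrite -/(m u v) -[qform _ _ u]/(m u u) -[qform _ _ v]/(m v v).
have pu : 0 <= m u u := psdM u.
have pv : 0 <= m v v := psdM v.
have [v0|vn0] := eqVneq (m v v) 0.
  (* When [v] has seminorm zero the quadratic in [t] is affine; a nonzero slope would let it reach
     -1, at the [t] chosen below. *)
  have key t : 0 <= m u u + t * (2 * m u v).
    have : 0 <= m (u + t *: v) (u + t *: v) := psdM _.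
    by rewrite !mE (mC v u) v0; lra.
  suff -> : m u v = 0 by rewrite expr0n /= v0 mulr0.
  apply/eqP/negPn/negP => uv0.
  have := key (- (m u u + 1) / (2 * m u v)).
  rewrite divfK ?mulf_neq0 ?pnatr_eq0 //; lra.
have vp : 0 < m v v by rewrite lt_neqAle eq_sym vn0.
(* This is [m v v] times the component of [u] orthogonal to [v], which avoids a division. *)
have : 0 <= m (m v v *: u - m u v *: v) (m v v *: u - m u v *: v) := psdM _.
rewrite !mE (mC v u).
rewrite [X in 0 <= X](_ : _ = m v v * (m u u * m v v - m u v ^+ 2)); last ring.
by rewrite pmulr_rge0 // subr_ge0.
Qed.

(** Cauchy-Schwarz for the pair [M u], [u] bounds the square of [dU (M u) (M u)] by a multiple of
    [qform dU M u]. *)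
Lemma qform_eq0 u : qform dU M u = 0 -> M u = 0.
Proof.
move=> u0; apply: (form_eq0 (dU := dU)).
have := qform_CauchySchwarz (M u) u.
by rewrite u0 mulr0 => h; apply/eqP; rewrite -sqrf_eq0 eq_le h sqr_ge0.
Qed.

Lemma dot_le_qnorm u v : dU u (M v) <= qnorm dU M u * qnorm dU M v.
Proof.
rewrite -sqrtrM ?psdM //; apply: le_trans (ler_norm _) _.
by rewrite -sqrtr_sqr ler_wsqrtr // qform_CauchySchwarz.
Qed.

Lemma qnormZ a u : qnorm dU M (a *: u) = `|a| * qnorm dU M u.
Proof.
rewrite /qnorm -sqrtr_sqr -sqrtrM ?sqr_ge0 //; congr Num.sqrt.
by rewrite /qform -/(m _ _) !mE /m; ring.
Qed.

Lemma halpern_rate (w t : nat -> U) (ws : U) :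
  (forall k, w k.+1 = k.+2%:R^-1 *: w 0%N + (1 - k.+2%:R^-1) *: t k) ->
  (forall k, qform dU M (t k.+1 - t k) <= qform dU M (w k.+1 - w k)) ->
  (forall k, qform dU M (t k - ws) <= qform dU M (w k - ws)) ->
  forall k, qnorm dU M (w k - t k) <= 2 * qnorm dU M (w 0%N - ws) / k.+1%:R.
Proof.
move=> wS tt tws k; pose r i := w i - t i.
have tE i : t i = w i - r i by rewrite /r opprB addrC subrK.
(* Lieder's invariant; the induction step is nonexpansiveness applied to
   [w k.+1] and [w k]. *)
have pot : k%:R / 2 * m (r k) (r k) <= m (w 0%N - w k) (r k).
  elim: k => [|k IH]; first by rewrite mul0r mul0r subrr /m linear0l.
  have := tt k; rewrite !tE -![qform _ _ _]/(m _ _).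
  move: IH; set a := w 0%N - w k; set n : R := k.+2%:R.
  have -> : k%:R = n - 2 :> R by rewrite /n -[k.+2]addn2 natrD; ring.
  have -> : k.+1%:R = n - 1 :> R by rewrite /n -[k.+2]addn1 natrD; ring.
  have n1 : 1 < n by rewrite /n ltr1n.
  rewrite wS tE -/n (_ : w 0%N = a + w k); last by rewrite subrK.
  move: (r k.+1) (r k) (w k) a => r' s b a IH.
  have E : a + b - (b - s) = a + s by rewrite opprB addrACA subrr addr0.
  rewrite scalerBl scale1r addrCA -scalerBr E.
  rewrite [X in m X X <= _ -> _](_ : _ = n^-1 *: (a + s) - r'); last first.
    by rewrite [X in X - r' - _]addrC addrAC addrK.
  rewrite [X in _ <= m X X -> _](_ : _ = n^-1 *: (a + s) - s); last first.
    by rewrite addrAC [b - s - b]addrAC subrr sub0r addrC.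
  rewrite opprD addrA E.
  rewrite {E}; move: IH; have -> : m a s = m (a + s) s - m s s.
    by rewrite mDl addrK.
  (* Here [d] is [w 0 - t k], and [IH] reads [n / 2 * m s s <= m d s]. Hence [n^-1 *: d - s] is no
     longer than [n^-1 *: d]; by [tr] neither is [n^-1 *: d - r'], which is the invariant at
     [k.+1]. *)
  move: (a + s) => d; rewrite !mE (mC s d) (mC r' d) => IH tr.
  have n0 : n != 0 by rewrite gt_eqF //; lra.
  have {}IH : m s s <= 2 * (n^-1 * m d s).
    have -> : m s s = n^-1 * (n * m s s) by rewrite mulKf.
    rewrite [leRHS]mulrCA ler_pM2l ?invr_gt0; lra.
  have {}tr : m r' r' <= 2 * (n^-1 * m d r').
    by move: (n^-1) IH tr => i IH tr; lra.
  have -> : m d r' - n^-1 * m d r' = (n - 1) / 2 * (2 * (n^-1 * m d r')).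
    by field.
  by rewrite ler_pM2l //; lra.
(* Nonexpansiveness towards [ws] gives [m s s / 2 <= m x s] for [s = r k] and [x = w k - ws]. Added
   to the invariant it eliminates [x] and raises the factor [k / 2] to [(k + 1) / 2]; Cauchy-Schwarz
   then allows division by the seminorm of [s]. *)
have := tws k; rewrite [in t k - ws]tE -[w k - r k - ws]addrAC.
rewrite -![qform _ _ _]/(m _ _).
move: pot; have -> : w 0%N - w k = w 0%N - ws - (w k - ws).
  by rewrite opprB addrA subrK.
rewrite -/(r k); move: (w k - ws) (w 0%N - ws) (r k) => x x0 s.
rewrite !mE (mC s x) => pot rx.
have : k.+1%:R / 2 * m s s <= m x0 s by rewrite -natr1; lra.
move=> /le_trans/(_ (dot_le_qnorm _ _)).
rewrite ler_pdivlMr ?ltr0Sn // -[m _ _](sqr_sqrtr (psdM _)) -/(qnorm dU M _).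
have : 0 <= qnorm dU M s by exact: sqrtr_ge0.
rewrite le_eqVlt => /predU1P[<- _|rp].
  by rewrite mul0r mulr_ge0 ?sqrtr_ge0.
by rewrite expr2 mulrA ler_pM2r // => H; lra.
Qed.

(** Stated on increments between two points: [dt] of the forward-backward step, [dF] of the
    gradient, [dv] of the monotone part. *)
Lemma relaxed_nonexpansive (beta rho : R) (dw dt dF dv : U) :
  0 < beta -> 0 < rho <= 2 - beta -> dF \in limg M ->
  (2 * beta)^-1 * qform dU (mpinv dU M) dF <= dU dF dw ->
  0 <= dU dv dt -> M dw - dF = M dt + dv ->
  qform dU M ((1 - rho) *: dw + rho *: dt) <= qform dU M dw.
Proof.
move=> b0 /andP[r0 rb] /memv_imgP[a _ ->].
(* By [M N M = M], the dual seminorm of [M a] is the primal seminorm of [a], whichever preimage [a]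
   is taken. *)
have [MNM _ _ _] := mpinvP saM.
have -> : qform dU (mpinv dU M) (M a) = m a a.
  by rewrite /qform saM /m -[in RHS]MNM !comp_lfunE.
rewrite saM -/(m a dw) => coco mono eqM.
pose e := dw - dt.
have dtE : dt = dw - e by rewrite /e opprB addrC subrK.
have dvE : dv = M (e - a).
  by rewrite linearB /= [M e]linearB /= addrAC eqM addrC addKr.
clearbody e; move: mono; rewrite dvE saM -/(m _ _) dtE.
rewrite [(1 - rho) *: dw + _](_ : _ = dw - rho *: e); last first.
  by rewrite scalerBl scale1r scalerBr addrA subrK.
rewrite -![qform _ _ _]/(m _ _) !mE (mC e dw) => mono.
(* Young: [2 beta <a, e>_M <= |a|^2_M + beta^2 |e|^2_M] *)
have : 0 <= m (a - beta *: e) (a - beta *: e) := psdM _.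
rewrite !mE (mC e a) => young.
have {}coco : m a a <= 2 * beta * m a dw.
  by rewrite -ler_pdivrMl // mulr_gt0.
have {}mono : (2 - beta) * m e e <= 2 * m dw e.
  rewrite -(ler_pM2l b0); have := mulr_ge0 (ltW b0) mono; lra.
have ee : 0 <= m e e := psdM e.
(* This compares the two terms by which the squares of [dw - rho *: e] and [dw] differ. *)
have : rho * (rho * m e e) <= rho * (2 * m dw e).
  rewrite ler_pM2l //; apply: le_trans mono.
  exact: ler_wpM2r.
lra.
Qed.

End SemiInnerProduct.

(** * Subgradients and optimality conditions of the subproblems *)

Section Subdifferential.
Context {R : realType} {V : euclideanType R}.
Implicit Types (p : V -> \bar R) (x u : V).

Lemma subdiff_fin_num p x u : proper p -> subdiff p x u -> p x \is a fin_num.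
Proof.
move=> [pNy [y py]] /(_ y) le; rewrite fin_numElt pNy /=.
by case: (p x) (pNy x) (le_lt_trans le py) => [r||] _ /=; rewrite ?ltry ?ltNyr.
Qed.

Lemma subdiff_monotone p x x' u u' : proper p ->
  subdiff p x u -> subdiff p x' u' -> 0 <= edot (u - u') (x - x').
Proof.
move=> pp su su'; move: (subdiff_fin_num pp su) (subdiff_fin_num pp su').
move: (su x') (su' x).
case: (p x) => // a; case: (p x') => // b; rewrite -!EFinD !lee_fin.
by rewrite -[x' - x]opprB linearN formBl /= => h1 h2 _ _; lra.
Qed.

(** Fermat's rule for a convex function plus a function quadratic on lines through [x], with
    gradient [- u] there. Minimality at [x + t *: (y - x)] and convexity of [p] give the subgradient
    inequality up to an error [t * C], for small [t]. *)
Lemma argmin_subdiff p (phi : V -> R) x u : proper p -> econvex p ->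
  (forall h, exists C, forall t,
     phi (x + t *: h) = phi x - t * edot u h + t ^+ 2 * C) ->
  argmin (fun y => p y + (phi y)%:E)%E x -> subdiff p x u.
Proof.
move=> [pNy [y0 py0]] cvx phiE xmin y.
have px : p x \is a fin_num.
  rewrite fin_numElt pNy /=; have := xmin y0.
  case: (p x) (pNy x) => //.
  by case: (p y0) py0 => // r _ _.
have [C {}phiE] := phiE (y - x).
have {}xmin t : 0 <= t <= 1 ->
    (p x <= t%:E * p y + (1 - t)%:E * p x
            + (t ^+ 2 * C - t * edot u (y - x))%:E)%E.
  move=> t01; have := xmin (x + t *: (y - x)).
  have := cvx y x t t01; have := phiE t.
  have -> : t *: y + (1 - t) *: x = x + t *: (y - x).
    by rewrite scalerBl scale1r scalerBr addrCA.
  move: (x + t *: (y - x)) => z ->.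
  move: (t%:E * p y + _)%E => W; case: (p x) px => // a _.
  case: (p z) (pNy z) => [b _||] //; case: W => [s||] //.
  - by rewrite -!EFinD !lee_fin => h1 h2; lra.
  - by move=> *; rewrite addye // leey.
  - by move=> *; rewrite addye // leey.
case: (p x) px xmin => // a _; case: (p y) (pNy y) => [b _||//]; last first.
  by rewrite leey.
move=> xmin; rewrite -EFinD lee_fin.
rewrite leNgt; apply/negP => lt0.
pose D := a + edot u (y - x) - b.
have D0 : 0 < D by rewrite /D subr_gt0.
pose N := D + `|C| + 1.
have N0 : 0 < N by rewrite /N ltr_wpDl // addr_ge0 ?(ltW D0).
have tN : D / N * N = D by rewrite divfK // gt_eqF.
have t0 : 0 < D / N by rewrite divr_gt0.
have t1 : D / N <= 1 by rewrite ler_pdivrMr // mul1r /N -addrA lerDl addr_ge0.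
have := xmin (D / N); rewrite (ltW t0) t1 => /(_ isT).
rewrite -!EFinM -!EFinD lee_fin.
move: (D / N) tN t0 t1 => t tN t0 t1 H.
have : t * D <= t * (t * C) by rewrite /D; lra.
rewrite ler_pM2l // => DC.
have : t * C <= t * `|C| by rewrite ler_pM2l // ler_norm.
have : t * (D + 1) > 0 by rewrite mulr_gt0 // addr_gt0.
move: tN; rewrite /N; lra.
Qed.

End Subdifferential.

(** Shared by both subproblems: [x'] is the linearization point, [a] the gradient there, [b] the
    multiplier term, and [d] the part of the constraint residual held fixed. The vector [u] is minus
    the gradient of [phi] at [x]. *)
Lemma linearized_objective_line {R : realType} {U W : vectType R}
    (dU : {dot U for (@idfun R)}) (dW : {dot W for (@idfun R)})
    (Sf S : 'End(U)) (L : 'Hom(U, W)) (sigma : R) (x x' a b : U) (d : W) :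
  selfadjoint dU Sf -> selfadjoint dU S ->
  let phi y := dU a (y - x') + 2^-1 * qform dU Sf (y - x') + dU b y
    + sigma / 2 * dW (L y + d) (L y + d) + 2^-1 * qform dU S (y - x') in
  let u := (S + Sf) (x' - x) - a - b - sigma *: adjoint dU dW L (L x + d) in
  forall h t, phi (x + t *: h) = phi x - t * dU u h + t ^+ 2 *
    (2^-1 * qform dU Sf h + sigma / 2 * dW (L h) (L h) + 2^-1 * qform dU S h).
Proof.
move=> saSf saS phi u h t; rewrite {}/phi {}/u [x + t *: h - x']addrAC.
rewrite !qformDZ //.
have -> : L (x + t *: h) + d = L x + d + t *: L h.
  by rewrite linearD linearZ addrAC.
have -> : (S + Sf) (x' - x) = - (S (x - x') + Sf (x - x')).
  by rewrite add_lfunE -[x' - x]opprB !linearN opprD.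
move: (x - x') => u; move: (L x + d) => l.
rewrite !(formDl, formDr, formZl, formZr, formNl) /=.
rewrite [dU (adjoint _ _ _ _) h]formC -adjointE [dW l (L h)]formC.
by field.
Qed.

Lemma normr_edot (R : realType) (V : euclideanType R) (v : V) :
  `|v| ^+ 2 = edot v v.
Proof.
rewrite enormE sqr_sqrtr //; have [->|vn0] := eqVneq v 0.
  by rewrite linear0r.
exact/ltW/neq0_dnorm_gt0.
Qed.

Lemma argmin_linearized_subdiff {R : realType} {V X : euclideanType R}
    (p : V -> \bar R) (f : V -> R) (Sf S : 'End(V)) (L : 'Hom(V, X))
    (sigma : R) (x x' b : V) (d : X) :
  proper p -> econvex p -> selfadjoint edot Sf -> selfadjoint edot S ->
  argmin (fun y => p y + (major f Sf y x' + edot b y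
    + sigma / 2 * `|(L y + d)%R| ^+ 2
    + 2^-1 * qform edot S (y - x'))%R%:E)%E x ->
  subdiff p x ((S + Sf) (x' - x) - grad f x' - b
               - sigma *: adjoint edot edot L (L x + d)).
Proof.
move=> pp cvx saSf saS; apply: argmin_subdiff => // h.
eexists => t; rewrite /major !normr_edot -!addrA -mulrN; congr (_ + _).
have := linearized_objective_line edot L sigma x x' (grad f x') b d
  saSf saS h t.
by rewrite /= -!addrA mulrN; apply.
Qed.

(** * The operator [M] and the identification of an ADMM step with [T] *)

Section MajorizedADMM.
Context {R : realType} {Y Z X : euclideanType R}.
Local Notation H := (Y * Z * X)%type.
Context {p : Y -> \bar R} {q : Z -> \bar R} {f : Y -> R} {g : Z -> R}.
Context {A : 'Hom(Y, X)} {B : 'Hom(Z, X)} {c : X} {sigma : R}.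
Context {Pf : 'End(Y)} {Pg : 'End(Z)}.
Context (sigma_gt0 : 0 < sigma) (proper_p : proper p) (proper_q : proper q).
Context (Pf_sa : selfadjoint edot Pf) (Pg_sa : selfadjoint edot Pg).
Context (Pf_psd : psd edot Pf) (Pg_psd : psd edot Pg).
Local Notation M := (Mop A sigma Pf Pg).
Implicit Types w t v : H.

Lemma pdotE w t :
  (pdot : {dot H for (@idfun R)}) w t =
    edot w.1.1 t.1.1 + edot w.1.2 t.1.2 + edot w.2 t.2.
Proof. by []. Qed.

Lemma Mop_selfadjoint : selfadjoint pdot M.
Proof.
move=> w t; rewrite !MopE !pdotE /= !(formDl, formDr, formZl, formZr).
rewrite !Pf_sa !Pg_sa -!adjointE.
rewrite [edot (adjoint _ _ _ (A _)) _]formC -adjointE.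
rewrite [edot (adjoint _ _ _ w.2) _]formC -adjointE.
rewrite [edot (A t.1.1) _]formC [edot (A t.1.1) w.2]formC.
by ring.
Qed.

(** Completing the square absorbs the coupling through [A], which exhibits both the positivity of
    [M] and its kernel. *)
Lemma qform_Mop w : let s := A w.1.1 + sigma^-1 *: w.2 in
  qform pdot M w =
    qform edot Pf w.1.1 + qform edot Pg w.1.2 + sigma * edot s s.
Proof.
rewrite /qform MopE !pdotE /= !(formDl, formDr, formZl, formZr) -!adjointE.
rewrite [edot w.2 (A _)]formC.
by field; rewrite gt_eqF.
Qed.

Lemma Mop_psd : psd pdot M.
Proof.
move=> w; rewrite -/(qform _ _ _) qform_Mop !addr_ge0 ?Pf_psd ?Pg_psd //.
by rewrite mulr_ge0 ?(ltW sigma_gt0) -?normr_edot ?exprn_ge0.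
Qed.

Lemma Rns_monotone w t v v' : Rns p q A B c w v -> Rns p q A B c t v' ->
  0 <= pdot (v - v') (w - t).
Proof.
case=> [a aP [b bP <-]] [a' a'P [b' b'P <-]].
have := subdiff_monotone proper_p aP a'P.
have := subdiff_monotone proper_q bP b'P.
rewrite pdotE /= !(formDl, formDr, formNl, formNr) /=.
rewrite ![edot (adjoint _ _ _ _) _]formC -!adjointE.
by lra.
Qed.

Lemma KKT_fixed_point w :
  KKT p q f g A B c w -> Tgraph p q f g A B c M w w.
Proof.
case=> v wv vF0; exists v => //; congr (_ + _).
by apply/eqP; rewrite eq_sym -addr_eq0 vF0.
Qed.

Lemma pd_add_comp_eq0 (V : euclideanType R) (P : 'End(V)) (L : 'Hom(V, X)) u :
  pd edot (P + sigma *: (adjoint edot edot L \o L)%VF) ->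
  qform edot P u = 0 -> L u = 0 -> u = 0.
Proof.
move=> PLpd Pu Lu; apply/eqP/contraT => /PLpd.
rewrite add_lfunE scale_lfunE comp_lfunE Lu linear0 scaler0 addr0.
by rewrite -/(qform _ _ _) Pu ltxx.
Qed.

(** Since [M] may be singular, monotonicity of [Rns] only yields [M (t - t') = 0] and equal values
    [v], [v']. Comparing the rows of these values shows that the [Y] and [Z] parts of the difference
    lie in the kernels of [A] and [B], where the two definiteness hypotheses apply. *)
Lemma Tgraph_functional w t t' :
  pd edot (Pf + sigma *: (adjoint edot edot A \o A)%VF) ->
  pd edot (Pg + sigma *: (adjoint edot edot B \o B)%VF) ->
  Tgraph p q f g A B c M w t -> Tgraph p q f g A B c M w t' -> t = t'.
Proof.
move=> Apd Bpd [v tv wv] [v' tv' wv'].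
have Md : M (t - t') = v' - v.
  have E : M t + v = M t' + v' by rewrite -wv -wv'.
  apply/eqP; rewrite linearB /= subr_eq addrAC eq_sym subr_eq E.
  by rewrite addrC.
have q0 : qform pdot M (t - t') = 0.
  apply/eqP; rewrite eq_le Mop_psd andbT.
  rewrite /qform Md -[v' - v]opprB formNr oppr_le0 formC.
  exact: Rns_monotone tv tv'.
have vv' : v = v'.
  apply/esym/eqP; rewrite -subr_eq0 -Md.
  by rewrite (qform_eq0 Mop_selfadjoint Mop_psd q0).
have t_eq : t - t' = 0; last by apply/eqP; rewrite -subr_eq0 t_eq.
move: q0; rewrite qform_Mop.
case: tv => [a aP [b bP vE]]; case: tv' => [a' a'P [b' b'P v'E]].
have := subdiff_monotone proper_q bP b'P.
move: vv'; rewrite -vE -v'E => -[_ bE cE].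
(* Monotonicity of [subdiff q] gives [0 <= <A dy, dx>], while the square in
   [qform_Mop] vanishes, so [A dy = - dx / sigma]: hence [dx = 0]. *)
set d := t - t'.
have -> : b - b' = - adjoint edot edot B d.2.
  rewrite linearB opprB /=; apply/eqP; rewrite subr_eq addrAC.
  by rewrite [adjoint _ _ B t'.2 + _]addrC -bE addrK.
(* The constraint rows of [v] and [v'] agree. *)
have /eqP ABd : A d.1.1 + B d.1.2 = 0.
  have /oppr_inj E : - (A t.1.1 + B t.1.2) = - (A t'.1.1 + B t'.1.2).
    by rewrite !opprD; exact: addIr cE.
  by rewrite !linearB /= addrACA -opprD E subrr.
rewrite -[t.1.2 - t'.1.2]/d.1.2 formNl formC -adjointE.
rewrite (_ : B d.1.2 = - A d.1.1); last first.
  by apply/eqP; rewrite -addr_eq0 addrC.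
rewrite formNl opprK; clearbody d => Axge0 q0.
have edot_ge0 (V : euclideanType R) (u : V) : 0 <= edot u u.
  by rewrite -normr_edot exprn_ge0.
move/eqP: q0; rewrite paddr_eq0 ?addr_ge0 ?Pf_psd ?Pg_psd //; last first.
  by rewrite mulr_ge0 // ltW.
rewrite paddr_eq0 ?Pf_psd ?Pg_psd // mulf_eq0 (gt_eqF sigma_gt0) /=.
case/andP=> /andP[/eqP Pfy /eqP Pgz] /eqP/form_eq0/eqP.
rewrite addr_eq0 => /eqP Ay.
have x0 : d.2 = 0.
  apply: (form_eq0 (dU := edot)); apply/eqP; rewrite eq_le edot_ge0 andbT.
  move: Axge0; rewrite Ay formNl formZl oppr_ge0 pmulr_rle0 // invr_gt0 //.
have Ay0 : A d.1.1 = 0 by rewrite Ay x0 scaler0 oppr0.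
have Bz0 : B d.1.2 = 0 by move: ABd; rewrite Ay0 add0r => /eqP.
move: (pd_add_comp_eq0 Apd Pfy Ay0) (pd_add_comp_eq0 Bpd Pgz Bz0) x0.
by move: d {ABd Axge0 Pfy Pgz Ay Ay0 Bz0} => [[y z] x] /= -> -> ->.
Qed.

(** The rows of the inclusion are the optimality conditions in [y] and [z] and the multiplier
    update. The update trades the penalty residual at the old [y] for [t.2 - w.2], which produces
    the off-diagonal blocks of [M]. *)
Lemma admm_step_Tgraph (Sf S : 'End(Y)) (Sg T : 'End(Z)) w t :
  econvex p -> econvex q ->
  selfadjoint edot Sf -> selfadjoint edot S ->
  selfadjoint edot Sg -> selfadjoint edot T ->
  admm_step p q f g A B c sigma Sf Sg S T w t ->
  Tgraph p q f g A B c (Mop A sigma (S + Sf) (T + Sg)) w t.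
Proof.
move=> cvx_p cvx_q saSf saS saSg saT [zmin xE ymin].
exists (Mop A sigma (S + Sf) (T + Sg) w - Fsm f g w
        - Mop A sigma (S + Sf) (T + Sg) t); last by rewrite [RHS]addrC subrK.
have rE z : A w.1.1 + B z - c = B z + (A w.1.1 - c) by rewrite addrAC addrC.
have zsub := argmin_linearized_subdiff (L := B) (sigma := sigma)
  (b := adjoint edot edot B w.2) (d := A w.1.1 - c) (x := t.1.2)
  proper_q cvx_q saSg saT.
have ysub := argmin_linearized_subdiff (L := A) (sigma := sigma)
  (b := adjoint edot edot A t.2) (d := B t.1.2 - c) (x := t.1.1)
  proper_p cvx_p saSf saS.
eexists.
  by apply: ysub => y; have := ymin y; rewrite /yobj -!(addrA (A _)); apply.
eexists.
  by apply: zsub => z; have := zmin z; rewrite /zobj !rE; apply.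
rewrite !MopE /block /Fsm -rE addrA xE.
congr (_, _, _) => /=.
- rewrite !(linearD, linearN, linearZ) /=; apply: (form_inj (dU := edot)) => u.
  by rewrite !(formDl, formNl, formZl); ring.
- rewrite !(linearD, linearN, linearZ) /=; apply: (form_inj (dU := edot)) => u.
  by rewrite !(formDl, formNl, formZl); ring.
- rewrite subr0; apply: (form_inj (dU := edot)) => u.
  by rewrite !(formDl, formNl, formZl); field; rewrite gt_eqF.
Qed.

End MajorizedADMM.

(** * Residual bounds for the accelerated iteration *)

Unset Implicit Arguments.
Set Strict Implicit.

Theorem theorem4p2 (R : realType) (Y Z X : euclideanType R)
  (p : Y -> \bar R) (q : Z -> \bar R) (f : Y -> R) (g : Z -> R)
  (A : 'Hom(Y, X)) (B : 'Hom(Z, X)) (c : X)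
  (hp : closed_proper_convex p) (hq : closed_proper_convex q)
  (f_convex : convex_function [set: convex_lmodType Y] f)
  (g_convex : convex_function [set: convex_lmodType Z] g)
  (f_diff : forall y, differentiable f y)
  (g_diff : forall z, differentiable g z)
  (f_lip : lipschitz (grad f)) (g_lip : lipschitz (grad g))
  (Sf : 'End(Y)) (Sg : 'End(Z))
  (Sf_selfadjoint : selfadjoint edot Sf) (Sf_psd : psd edot Sf)
  (Sg_selfadjoint : selfadjoint edot Sg) (Sg_psd : psd edot Sg)
  (f_major : forall y y', f y <= major f Sf y y')
  (g_major : forall z z', g z <= major g Sg z z')
  (sigma : R) (sigma_gt0 : 0 < sigma)
  (S : 'End(Y)) (T : 'End(Z))
  (S_selfadjoint : selfadjoint edot S) (T_selfadjoint : selfadjoint edot T) :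
  let Pf : 'End(Y) := S + Sf in
  let Pg : 'End(Z) := T + Sg in
  let M := Mop A sigma Pf Pg in
  let F := Fsm (X := X) f g in
  KKT p q f g A B c !=set0 ->
  psd edot Pf -> psd edot Pg ->
  pd edot (Pf + sigma *: (adjoint edot edot A \o A)%VF) ->
  pd edot (Pg + sigma *: (adjoint edot edot B \o B)%VF) ->
  forall beta : R, 0 < beta <= 1 ->
  (forall w1 w2 : Y * Z * X,
     F w1 - F w2 \in limg M /\
     (2 * beta)^-1 * qform pdot (mpinv pdot M) (F w1 - F w2)
       <= pdot (F w1 - F w2) (w1 - w2)) ->
  forall rho : R, 0 < rho <= 2 - beta ->
  forall (w0 : Y * Z * X) (w : nat -> Y * Z * X), w 0%N = w0 ->
  halpern_admm p q f g A B c sigma Sf Sg S T rho w ->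
  let TM := Tmap p q f g A B c M in
  forall ws, KKT p q f g A B c ws -> forall k : nat,
    qnorm pdot M (w k - relaxed rho TM (w k))
      <= 2 * qnorm pdot M (w0 - ws) / k.+1%:R /\
    qnorm pdot M (w k - TM (w k))
      <= 2 * qnorm pdot M (w0 - ws) / (rho * k.+1%:R).
Proof.
move=> Pf Pg M F _ Pf_psd Pg_psd Apd Bpd beta b01 coco rho rho2 w0 w w0E admm.
move=> TM ws wsK k.
have [lsc_p proper_p cvx_p] := hp; have [lsc_q proper_q cvx_q] := hq.
have saD (V : euclideanType R) (P Q : 'End(V)) :
    selfadjoint edot P -> selfadjoint edot Q -> selfadjoint edot (P + Q).
  by move=> sP sQ u v; rewrite !add_lfunE formDl formDr sP sQ.
have Pf_sa : selfadjoint edot Pf by exact: saD.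
have Pg_sa : selfadjoint edot Pg by exact: saD.
have saM : selfadjoint pdot M := Mop_selfadjoint Pf_sa Pg_sa.
have psdM : psd pdot M := Mop_psd sigma_gt0 Pf_psd Pg_psd.
have /choice[t tP] i : exists wt,
    admm_step p q f g A B c sigma Sf Sg S T (w i) wt /\
    w i.+1 = i.+2%:R^-1 *: w 0%N
             + (1 - i.+2%:R^-1) *: ((1 - rho) *: w i + rho *: wt).
  by have [wt] := admm i; exists wt.
have tT i : Tgraph p q f g A B c M (w i) (t i).
  by apply: admm_step_Tgraph; case: (tP i).
(* The ADMM step itself supplies a point of the graph, so [Tmap] does not return its default value
   at [w i]; uniqueness identifies the two points. *)
have TME i : TM (w i) = t i.
  apply: (Tgraph_functional sigma_gt0 proper_p proper_q Pf_sa Pg_sa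
    Pf_psd Pg_psd Apd Bpd _ (tT i)).
  apply: (xgetPex 0 (P := [set w' | Tgraph p q f g A B c M (w i) w'])).
  by exists (t i); exact: tT.
(* Phrased on pairs of the graph, so that it serves both for successive iterates and for the pair
   [ws], [ws]. *)
have nonexp u u' v v' :
    Tgraph p q f g A B c M u v -> Tgraph p q f g A B c M u' v' ->
    qform pdot M (((1 - rho) *: u + rho *: v) - ((1 - rho) *: u' + rho *: v'))
    <= qform pdot M (u - u').
  move=> [a va ua] [a' va' ua'].
  have [Fim Fcoco] := coco u u'.
  have [b0 _] := andP b01.
  have := relaxed_nonexpansive saM psdM b0 rho2 Fim Fcoco
    (Rns_monotone proper_p proper_q va va').
  have -> : (1 - rho) *: (u - u') + rho *: (v - v') =
     ((1 - rho) *: u + rho *: v) - ((1 - rho) *: u' + rho *: v').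
    by rewrite !scalerBr opprD addrACA.
  apply; rewrite opprD !linearB /= addrACA -opprD ua ua'.
  by rewrite opprD addrACA.
have rho0 : 0 < rho by case/andP: rho2.
have wsE : ws = (1 - rho) *: ws + rho *: ws by rewrite -scalerDl subrK scale1r.
have rate : qnorm pdot M (w k - relaxed rho TM (w k))
    <= 2 * qnorm pdot M (w0 - ws) / k.+1%:R.
  rewrite -w0E /relaxed TME.
  apply: (halpern_rate saM psdM (t := fun i => (1 - rho) *: w i + rho *: t i)).
  - by move=> i; case: (tP i).
  - by move=> i; apply: nonexp.
  - by move=> i; rewrite {1}wsE; apply: nonexp => //; exact: KKT_fixed_point.
split=> //.
(* The two residuals are proportional, so the second bound follows by homogeneity of the
   seminorm. *)
have wE : w k - relaxed rho TM (w k) = rho *: (w k - TM (w k)).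
  rewrite /relaxed scalerBl scale1r scalerBr opprD opprB addrA.
  by rewrite addrCA subrr addr0.
move: rate; rewrite wE qnormZ (gtr0_norm rho0) => rate.
rewrite invfM mulrA mulrAC.
by rewrite ler_pdivlMr // mulrC.
Qed.
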